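(* Let $G$ be a compact group, let $\pi : G \to GL(\mathbb{R}^N)$ be a continuous linear representation, and put $\langle \pi \rangle = \langle \pi(g)\rangle_{g\in G}$ (Haar average). Let $V_0 = \operatorname{range}(\langle\pi\rangle) = \{\langle \pi\rangle x : x \in \mathbb{R}^N\}$ and $N_0 = \dim V_0$. Let $P\ge 1$ and let $r^1,\dots,r^P \in \mathbb{R}^N$ be such that the points $\langle\pi\rangle r^\mu$, $\mu\in\{1,\dots,P\}$, lie in general position in $V_0$. Then: (i) $V_0$ is the fixed point subspace of $\pi$, i.e. $V_0 = \{w\in\mathbb{R}^N : \pi(g)w = w \text{ for all } g\in G\}$; (ii) the fraction of the $2^P$ dichotomies that are linearly separable on the $P$ $\pi$-manifolds $\{\pi(g) r^\mu : g\in G\}$ is $f(P,N_0)$; (iii) $N_0$ equals the number of trivial irreducible representations that appear in the decomposition of $\pi$ into a direct sum of irreducible representations.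
   Context: $\langle \pi(g)\rangle_{g\in G}$ denotes the average of $\pi$ over $G$ with respect to the normalized Haar measure (for finite $G$, $\frac{1}{|G|}\sum_{g\in G}\pi(g)$). A $\pi$-manifold is an orbit $\{\pi(g) r : g\in G\}$ of a point $r\in\mathbb{R}^N$. A dichotomy is an assignment of labels $(y^\mu)_{\mu=1}^P\in\{-1,+1\}^P$; it is linearly separable on the $P$ $\pi$-manifolds if there exists $w\in\mathbb{R}^N$ with $y^\mu w^\top \pi(g) r^\mu > 0$ for all $g\in G$ and all $\mu\in\{1,\dots,P\}$ (no bias term). A family of $P$ points is in general position in a vector space of dimension $n$ if every subfamily of $n$ or fewer of the points is linearly independent. The function $f$ is $f(P,n) = 2^{1-P}\sum_{k=0}^{n-1}\binom{P-1}{k}$, with $\binom{a}{b}=0$ for $b>a$ and the empty sum (when $n=0$) equal to $0$. A trivial irreducible representation is the one-dimensional representation on which every $g$ acts as the identity. *)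

(* Defs.v *)
From HB Require Import structures.
From mathcomp Require Import all_boot all_order all_algebra.
From mathcomp Require Import all_classical all_reals all_analysis.

Set Implicit Arguments.
Unset Strict Implicit.
Unset Printing Implicit Defensive.

Import Order.TTheory GRing.Theory Num.Theory.
Import numFieldNormedType.Exports.

Local Open Scope classical_set_scope.
Local Open Scope ring_scope.

HB.mixin Record PointedTopologicalGroup_isTopological G
    of PointedTopological G & Group G := {
  mulg_continuous : continuous (fun x : G * G => (x.1 * x.2)%g);
  invg_continuous : continuous (fun x : G => (x^-1)%g)
}.

(* The base point only serves the library's measure theory, which is developed
   over pointed types; it is unrelated to the unit. *)
#[short(type="topGroupType")]
HB.structure Definition TopologicalGroup :=
  {G of PointedTopologicalGroup_isTopological G
      & PointedTopological G & Group G}.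

Notation borelType G := (g_sigma_algebraType (@open G)).

(* On a compact Hausdorff group there is exactly one such probability measure.
   Closed sets play the role of compact sets in inner regularity; the two
   notions agree on a compact Hausdorff space. *)
Definition normalized_haar (R : realType) (G : topGroupType)
    (mu : probability (borelType G) R) : Prop :=
  [/\ (forall (g : G) (A : set (borelType G)), measurable A ->
         mu [set (g * x)%g | x in A] = mu A),
      (forall A : set (borelType G), measurable A ->
         mu A = ereal_inf [set mu U | U in [set U | @open G U /\ A `<=` U]]) &
      (forall A : set (borelType G), measurable A ->
         mu A = ereal_sup [set mu K | K in [set K | @closed G K /\ K `<=` A]])].

Section Representation.
Variables (R : realType) (G : topGroupType) (N : nat).
Implicit Types (pi : G -> 'M[R]_N) (W : {vspace 'cV[R]_N}).

Definition continuous_representation pi : Prop :=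
  [/\ (forall g, pi g \in unitmx),
      (forall g h, pi (g * h)%g = pi g *m pi h) &
      continuous pi].

Definition haar_average (mu : probability (borelType G) R) pi : 'M[R]_N :=
  \matrix_(i, j) \int[mu]_(g in setT) pi g i j.

Definition mx_range (A : 'M[R]_N) : {vspace 'cV[R]_N} :=
  limg (linfun (mulmx A : 'cV[R]_N -> 'cV[R]_N)).

Definition manifold pi (r : 'cV[R]_N) : set 'cV[R]_N :=
  [set pi g *m r | g in [set: G]].

Definition invariant_subspace pi W : Prop :=
  forall g w, w \in W -> pi g *m w \in W.

Definition irreducible_subrep pi W : Prop :=
  [/\ W != 0%VS, invariant_subspace pi W &
      forall U : {vspace 'cV[R]_N}, (U <= W)%VS -> invariant_subspace pi U ->
        U = 0%VS \/ U = W].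

Definition irreducible_decomposition pi (m : nat)
    (W : 'I_m -> {vspace 'cV[R]_N}) : Prop :=
  [/\ (forall i, irreducible_subrep pi (W i)),
      directv (\sum_i W i)%VS &
      (\sum_i W i)%VS = fullv].

Definition trivial_irrep pi W : Prop :=
  \dim W = 1%N /\ forall g w, w \in W -> pi g *m w = w.

End Representation.

Definition general_position (K : fieldType) (vT : vectType K) (P : nat)
    (V : {vspace vT}) (x : 'I_P -> vT) : Prop :=
  (forall i, x i \in V) /\
  forall S : {set 'I_P}, (#|S| <= \dim V)%N -> free [seq x i | i <- enum S].

(* A dichotomy is encoded by booleans, [false] standing for the label +1 and
   [true] for -1. *)
Definition label (R : realType) (b : bool) : R := (-1) ^+ b.

Definition linearly_separable (R : realType) (N P : nat)
    (M : 'I_P -> set 'cV[R]_N) (y : {ffun 'I_P -> bool}) : Prop :=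
  exists w : 'cV[R]_N, forall (i : 'I_P) (x : 'cV[R]_N), M i x ->
    0 < label R (y i) * (w^T *m x) 0 0.

Definition separable_fraction (R : realType) (N P : nat)
    (M : 'I_P -> set 'cV[R]_N) : R :=
  #|[pred y : {ffun 'I_P -> bool} | `[< linearly_separable M y >]]|%:R
    / 2 ^+ P.

Definition cover_fraction (R : realType) (P n : nat) : R :=
  2 ^ (1 - P%:Z) * \sum_(0 <= k < n) 'C(P - 1, k)%:R.

(* Main.v *)
(** Write [A] for the Haar average of [pi]. Left invariance gives
    [pi g *m A = A], so [A] is a projection onto the fixed vectors; moreover
    [A *m pi g = A]. Integrating over a manifold, a separating [w] separates the
    points [A *m r i]; conversely [A^T *m w] is constant along each manifold, so
    separating the manifolds means finding [u] in the range of [A^T] with the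
    prescribed signs of [u^T *m r i]. These sign patterns are counted by Cover's
    recursion [C(P+1, n) = C(P, n) + C(P, n-1)]: a pattern on [P] functionals
    extends in both ways exactly when it is realized on the kernel of the new
    one. For (iii), [A] maps each irreducible summand onto itself if it is
    trivial and to 0 otherwise. *)
Require Import Defs.
From HB Require Import structures.
From mathcomp Require Import all_boot all_order all_algebra.
From mathcomp Require Import all_classical all_reals all_analysis.

Set Implicit Arguments.
Unset Strict Implicit.
Unset Printing Implicit Defensive.

Import Order.TTheory GRing.Theory Num.Theory.
Import numFieldNormedType.Exports.

Local Open Scope classical_set_scope.
Local Open Scope ring_scope.

(** * Integration against Haar measure *)

Section Integration.
Variables (R : realType) (G : topGroupType).
Variable mu : probability (borelType G) R.
Hypothesis G_compact : compact [set: G].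

Lemma continuous_borel_measurable (f : G -> R) :
  continuous f -> measurable_fun setT (f : borelType G -> R).
Proof.
move=> /continuousP cf.
apply: (measurability _ (measurable_realfun.RGenOpens.measurableE R)).
move=> _ [_ [a [b ->] <-]]; rewrite setTI.
by apply: sub_sigma_algebra; apply: cf; exact: interval_open.
Qed.

Lemma continuous_compact_integrable (f : G -> R) :
  continuous f -> mu.-integrable setT (EFin \o f).
Proof.
move=> cf; apply: measurable_bounded_integrable.
- exact: measurableT.
- by rewrite (le_lt_trans (probability_le1 mu measurableT)) // ltry.
- exact: continuous_borel_measurable.
- have /compact_bounded[M [Mreal HM]] :=
    continuous_compact (continuous_subspaceT cf) G_compact.
  by exists M; split => // x /HM H g _; apply: H; exists g.
Qed.

Lemma continuous_mulgl (h : G) : continuous (fun g : G => h * g)%g.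
Proof.
move=> x; apply: (@continuous_comp _ _ _ (fun g : G => (h, g))
  (fun x : G * G => (x.1 * x.2)%g)).
  by apply: cvg_pair; [exact: cvg_cst | exact: cvg_id].
exact: mulg_continuous.
Qed.

(** Left translation by [h] pushes [mu] forward to itself: [h] carries the preimage of [A] back onto
    [A], so left invariance gives both sets the same mass. The claim is then change of variables. *)
Lemma haar_translate (f : G -> R) (h : G) :
    normalized_haar mu -> continuous f ->
  \int[mu]_(g in setT) f (h * g)%g = \int[mu]_(g in setT) f g.
Proof.
move=> [mu_inv _ _] cf.
have mh : measurable_fun setT ((fun g => h * g)%g : borelType G -> borelType G).
  apply: (@measurability _ _ (borelType G) (borelType G) setT _ (@open G)) => //
    _ [U oU <-]; rewrite setTI; apply: sub_sigma_algebra.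
  by move: (@continuous_mulgl h) => /continuousP; exact.
rewrite /Rintegral; congr fine.
have := @integral_pushforward _ _ _ _ R _ mh mu setT (EFin \o f).
rewrite preimage_setT => <-; last exact: measurableT.
- apply: eq_measure_integral => A mA _; rewrite /= /pushforward -(mu_inv h).
    by rewrite image_preimage //; apply/seteqP; split => // x _;
      exists (h^-1 * x)%g => //; rewrite monoid.mulVKg.
  by rewrite -[X in measurable X]setTI; apply: mh.
- by apply/measurable_realfun.measurable_EFinP;
    exact: continuous_borel_measurable.
- apply: (@continuous_compact_integrable (fun g => f (h * g)%g)).
  by move=> x; apply: continuous_comp; [exact: continuous_mulgl | exact: cf].
Qed.

Lemma Rintegral_sum (I : Type) (s : seq I) (f : I -> G -> R) :
  (forall i, continuous (f i)) ->
  \int[mu]_(g in setT) (\sum_(i <- s) f i g) =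
  \sum_(i <- s) \int[mu]_(g in setT) f i g.
Proof.
move=> cf; elim: s => [|i s IHs].
  under eq_Rintegral do rewrite big_nil.
  by rewrite big_nil Rintegral_cst ?mul0r.
under eq_Rintegral do rewrite big_cons.
rewrite big_cons -IHs RintegralD //; apply: continuous_compact_integrable => //.
by move=> x; apply: (cvg_big add_continuous) => j _; exact: cf.
Qed.

Definition entrywise_continuous m n (F : G -> 'M[R]_(m, n)) : Prop :=
  forall i j, continuous (fun g => F g i j).

(** The rectangular version of [haar_average], which also covers orbits of column vectors and scalar
    products; [haar_average mu pi] is convertible to [mx_integral mu pi]. *)
Definition mx_integral m n (F : G -> 'M[R]_(m, n)) : 'M[R]_(m, n) :=
  \matrix_(i, j) \int[mu]_(g in setT) F g i j.

Lemma entrywise_continuous_cst m n (A : 'M[R]_(m, n)) :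
  entrywise_continuous (fun=> A).
Proof. by move=> i j; exact: cst_continuous. Qed.

Lemma entrywise_continuous_mul m n p (F : G -> 'M[R]_(m, n))
    (F' : G -> 'M[R]_(n, p)) :
  entrywise_continuous F -> entrywise_continuous F' ->
  entrywise_continuous (fun g => F g *m F' g).
Proof.
move=> cF cF' i j;
  rewrite (_ : (fun g => _) = fun g => \sum_k F g i k * F' g k j).
  by move=> g; apply: (cvg_big add_continuous) => k _; apply: cvgM;
    [exact: cF | exact: cF'].
by apply/funext => g; rewrite mxE.
Qed.

Lemma mx_integral_mull m n p (A : 'M[R]_(p, m)) (F : G -> 'M[R]_(m, n)) :
  entrywise_continuous F ->
    mx_integral (fun g => A *m F g) = A *m mx_integral F.
Proof.
move=> cF; apply/matrixP => i j; rewrite !mxE.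
under eq_Rintegral do rewrite mxE.
rewrite Rintegral_sum => [|k g]; last by apply: cvgM;
  [exact: cvg_cst | exact: cF].
apply: eq_bigr => k _; rewrite mxE RintegralZl //.
exact: continuous_compact_integrable.
Qed.

Lemma mx_integral_mulr m n p (F : G -> 'M[R]_(m, n)) (A : 'M[R]_(n, p)) :
  entrywise_continuous F ->
    mx_integral (fun g => F g *m A) = mx_integral F *m A.
Proof.
move=> cF; apply/matrixP => i j; rewrite !mxE.
under eq_Rintegral do rewrite mxE.
rewrite Rintegral_sum => [|k g]; last by apply: cvgM;
  [exact: cF | exact: cvg_cst].
apply: eq_bigr => k _; rewrite mxE RintegralZr //.
exact: continuous_compact_integrable.
Qed.

Lemma mx_integral_cst m n (A : 'M[R]_(m, n)) : mx_integral (fun=> A) = A.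
Proof.
apply/matrixP => i j; rewrite mxE Rintegral_cst //.
by rewrite (congr1 fine (probability_setT mu)) mulr1.
Qed.

Lemma mx_integral_translate m n (F : G -> 'M[R]_(m, n)) (h : G) :
  normalized_haar mu -> entrywise_continuous F ->
  mx_integral (fun g => F (h * g)%g) = mx_integral F.
Proof.
move=> haar cF; apply/matrixP => i j; rewrite !mxE.
exact: (@haar_translate (fun g => F g i j)).
Qed.

(** By compactness [f] attains its minimum at some [c]. As [mu] has mass one, the integral is at
    least [f c], which is positive. *)
Lemma Rintegral_gt0 (f : G -> R) :
  continuous f -> (forall g, 0 < f g) -> 0 < \int[mu]_(g in setT) f g.
Proof.
move=> cf f_gt0.
have [|c _ c_min] := compact_EVT_min _ G_compact (continuous_subspaceT cf).
  by exists point.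
apply: (lt_le_trans (f_gt0 c)).
rewrite -[leLHS]mulr1 -[X in _ * X]/(fine 1%:E)
  -(congr1 fine (probability_setT mu)).
rewrite -Rintegral_cst //; apply: le_Rintegral => //.
- by apply: (@continuous_compact_integrable (fun=> f c)); exact: cst_continuous.
- exact: continuous_compact_integrable.
- by move=> g _; apply: c_min; rewrite inE.
Qed.
End Integration.

(** * The Haar average as an invariant projection *)

Section HaarAverage.
Variables (R : realType) (G : topGroupType) (N : nat).
Variables (mu : probability (borelType G) R) (pi : G -> 'M[R]_N).
Hypotheses (G_compact : compact [set: G]) (mu_haar : normalized_haar mu).
Hypothesis pi_rep : continuous_representation pi.
Let A := haar_average mu pi.
Let piM g h : pi (g * h)%g = pi g *m pi h. Proof. by case: pi_rep. Qed.

Lemma rep1 : pi 1%g = 1%:M.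
Proof.
have [pi_unit _ _] := pi_rep.
have pi11 : pi 1%g *m pi 1%g = pi 1%g by rewrite -piM monoid.mulg1.
by rewrite -[LHS](mulKmx (pi_unit 1%g)) pi11 mulVmx.
Qed.

Lemma repV g : pi g *m pi g^-1%g = 1%:M.
Proof. by rewrite -piM monoid.mulgV rep1. Qed.

Lemma rep_entrywise_continuous : entrywise_continuous pi.
Proof.
move=> i j g; have [_ _ cpi] := pi_rep.
by apply: (@continuous_comp _ _ _ pi (fun M : 'M[R]_N => M i j));
  [exact: cpi | exact: coord_continuous].
Qed.

Lemma repV_entrywise_continuous : entrywise_continuous (fun g => pi g^-1%g).
Proof.
move=> i j g.
apply: (@continuous_comp _ _ _ (fun g : G => g^-1%g) (fun g => pi g i j)).
  exact: invg_continuous.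
exact: rep_entrywise_continuous.
Qed.

Lemma rep_haar_average g : pi g *m A = A.
Proof.
rewrite -[A]/(mx_integral mu pi) -(mx_integral_mull _ G_compact) //.
  rewrite -[RHS](mx_integral_translate G_compact g mu_haar) //.
    by congr mx_integral; apply/funext => h; rewrite piM.
  exact: rep_entrywise_continuous.
exact: rep_entrywise_continuous.
Qed.

Lemma mul_haar_average m (v : 'M[R]_(N, m)) :
  (forall g, pi g *m v = v) -> A *m v = v.
Proof.
move=> v_fix; rewrite -[A]/(mx_integral mu pi) -(mx_integral_mulr _ G_compact).
  by rewrite (_ : (fun g => _) = fun=> v) ?mx_integral_cst //; apply/funext.
exact: rep_entrywise_continuous.
Qed.

(* Only left invariance of [mu] is available; with [B] the average of
   [pi g^-1], both [A] and [B] equal [B *m A], which replaces unimodularity. *)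
Lemma haar_average_rep g : A *m pi g = A.
Proof.
pose B := mx_integral mu (fun h => pi h^-1%g).
have BE h : B *m pi h = B.
  rewrite -(mx_integral_mulr _ G_compact);
    last exact: repV_entrywise_continuous.
  rewrite -[RHS](mx_integral_translate G_compact h^-1%g mu_haar);
    last exact: repV_entrywise_continuous.
  by congr mx_integral; apply/funext => k;
    rewrite monoid.invgM monoid.invgK piM.
have BA_B : B *m A = B.
  rewrite -[A]/(mx_integral mu pi) -(mx_integral_mull _ G_compact);
    last exact: rep_entrywise_continuous.
  by under eq_fun do rewrite BE; rewrite mx_integral_cst.
have BA_A : B *m A = A.
  rewrite -(mx_integral_mulr _ G_compact);
    last exact: repV_entrywise_continuous.
  by under eq_fun do rewrite rep_haar_average; rewrite mx_integral_cst.
by rewrite -BA_A BA_B BE.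
Qed.

Lemma mem_mx_range (M : 'M[R]_N) (w : 'cV_N) :
  w \in mx_range M <-> exists x, w = M *m x.
Proof.
split=> [/memv_imgP[x _ ->]|[x ->]]; first by exists x; rewrite lfunE.
by rewrite -[M *m x](lfunE (mulmx M)); apply: memv_img; rewrite memvf.
Qed.

Lemma mem_range_haar_average w :
  w \in mx_range A <-> forall g, pi g *m w = w.
Proof.
split=> [/mem_mx_range[x ->] g|w_fix]; first by rewrite mulmxA rep_haar_average.
by apply/mem_mx_range; exists w; rewrite mul_haar_average.
Qed.

(** Pairing with [w] commutes with integration, and a continuous function that is positive on all of
    [G] has a positive integral. Here [e] stands for the sign of a label. *)
Lemma haar_average_separable (r w : 'cV[R]_N) (e : R) :
  (forall g, 0 < e * (w^T *m (pi g *m r)) 0 0) -> 0 < e * (w^T *m (A *m r)) 0 0.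
Proof.
move=> sep; rewrite -[A]/(mx_integral mu pi).
have cpi := rep_entrywise_continuous.
have cpir := entrywise_continuous_mul cpi (@entrywise_continuous_cst R G _ _ r).
have cwpir := entrywise_continuous_mul (@entrywise_continuous_cst R G _ _ w^T)
  cpir.
rewrite -(mx_integral_mulr _ G_compact) // -(mx_integral_mull _ G_compact) //
  mxE.
rewrite -RintegralZl //; last exact: continuous_compact_integrable.
apply: (Rintegral_gt0 mu G_compact) => // g.
by apply: cvgM; [exact: cvg_cst | exact: cwpir].
Qed.
End HaarAverage.

(** * Irreducible decompositions *)

Section Decomposition.
Variables (R : realType) (G : topGroupType) (N : nat).
Variables (mu : probability (borelType G) R) (pi : G -> 'M[R]_N).
Hypotheses (G_compact : compact [set: G]) (mu_haar : normalized_haar mu).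
Hypothesis pi_rep : continuous_representation pi.
Implicit Types U V W : {vspace 'cV[R]_N}.

(** Turns abstract projections such as [projv W] into matrices, which can be moved in and out of
    [mx_integral]. *)
Lemma mx_of_lfun (f : 'End('cV[R]_N)) :
  exists M : 'M[R]_N, forall x, M *m x = f x.
Proof.
exists (\matrix_(i, j) f (delta_mx j 0) i 0) => x.
rewrite {2}(matrix_sum_delta x) linear_sum; apply/colP => i.
rewrite mxE summxE; apply: eq_bigr => j _.
by rewrite big_ord1 linearZ /= !mxE mulrC.
Qed.

(** A projection onto [W] fixes every value of [F] and commutes with the integral, so it fixes the
    integral too. *)
Lemma mx_integral_mem W (F : G -> 'cV[R]_N) :
  entrywise_continuous F -> (forall g, F g \in W) -> mx_integral mu F \in W.
Proof.
move=> cF FW; have [M ME] := mx_of_lfun (projv W).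
suff <- : M *m mx_integral mu F = mx_integral mu F by rewrite ME memv_proj.
rewrite -(mx_integral_mull _ G_compact) //; congr mx_integral.
by apply/funext => g; rewrite ME projv_id.
Qed.

(* Weyl's averaging trick applied to a projection onto [W]. *)
Lemma equivariant_projection W : invariant_subspace pi W ->
  exists T : 'M[R]_N, [/\ (forall g, pi g *m T = T *m pi g),
    (forall x, T *m x \in W) & (forall w, w \in W -> T *m w = w)].
Proof.
move=> W_inv; have [M ME] := mx_of_lfun (projv W).
have [_ piM _] := pi_rep.
have cpi := rep_entrywise_continuous pi_rep.
have cpiV := repV_entrywise_continuous pi_rep.
pose F g := pi g *m M *m pi g^-1%g.
have cF : entrywise_continuous F.
  apply: entrywise_continuous_mul => //; apply: entrywise_continuous_mul => //.
  exact: entrywise_continuous_cst.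
have repVg g : pi g^-1%g *m pi g = 1%:M.
  by rewrite -{2}[g]monoid.invgK (repV pi_rep).
have FxE g x : F g *m x = pi g *m projv W (pi g^-1%g *m x).
  by rewrite /F -!mulmxA ME.
exists (mx_integral mu F); split=> [g|x|w wW].
(* Commutation follows from translating by [g]: [F (g * h) *m pi g] equals [pi g *m F h]. *)
- rewrite -(mx_integral_mull _ G_compact) //
    -[in RHS](mx_integral_translate G_compact g mu_haar) //.
  rewrite -(mx_integral_mulr _ G_compact); last first.
    move=> i j h; apply: (@continuous_comp _ _ _ (fun h : G => g * h)%g
      (fun k => F k i j)); [exact: continuous_mulgl | exact: cF].
  congr mx_integral; apply/funext => h.
  by rewrite /F monoid.invgM !piM -!mulmxA repVg mulmx1.
- rewrite -(mx_integral_mulr _ G_compact) //; apply: mx_integral_mem.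
    by apply: entrywise_continuous_mul => //; exact: entrywise_continuous_cst.
  by move=> g; rewrite FxE; apply: W_inv; exact: memv_proj.
- rewrite -(mx_integral_mulr _ G_compact) // -[RHS](mx_integral_cst mu).
  congr mx_integral; apply/funext => g.
  by rewrite FxE projv_id ?W_inv // mulmxA (repV pi_rep) mul1mx.
Qed.

(** The complement is the kernel in [U] of an equivariant projection [T] onto [W]: it is invariant
    because [T] commutes with [pi], and [x] splits as [T x] plus [x - T x]. *)
Lemma invariant_complement U W :
  invariant_subspace pi U -> invariant_subspace pi W -> (W <= U)%VS ->
  exists C, [/\ invariant_subspace pi C, (W + C)%VS = U & (W :&: C)%VS = 0%VS].
Proof.
move=> U_inv /[dup] W_inv /equivariant_projection[T [T_comm TW T_id]] WU.
have memC x : (x \in U :&: lker (linfun (mulmx T)))%VS =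
    (x \in U) && (T *m x == 0).
  by rewrite memv_cap memv_ker lfunE.
exists (U :&: lker (linfun (mulmx T)))%VS; split.
- move=> g x; rewrite !memC => /andP[xU /eqP Tx].
  by rewrite U_inv //= mulmxA -T_comm -mulmxA Tx mulmx0.
- apply/eqP; rewrite eqEsubv subv_add WU capvSl /=.
  apply/subvP => x xU; rewrite -[x](subrKC (T *m x)).
  rewrite memv_add ?TW // memC memvB ?(subvP WU (T *m x)) ?TW //=.
  by rewrite mulmxBr (T_id (T *m x)) ?TW // subrr.
- apply/eqP; rewrite -subv0; apply/subvP => x.
  by rewrite memv_cap memC memv0 => /and3P[xW _]; rewrite T_id.
Qed.

(** Strong induction on the dimension: unless [U] is zero or irreducible, it splits into an
    invariant subspace and a complement, both smaller. The equality of dimensions is carried along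
    because it later expresses that the sum is direct. *)
Lemma irreducible_seq U : invariant_subspace pi U ->
  exists s : seq {vspace 'cV[R]_N},
    [/\ (forall W, W \in s -> irreducible_subrep pi W),
        (\sum_(W <- s) W)%VS = U & (\sum_(W <- s) \dim W)%N = \dim U].
Proof.
have [n] := ubnP (\dim U); elim: n U => // n IHn U /ltnSE dimU U_inv.
have [->|U_neq0] := eqVneq U 0%VS.
  by exists [::]; rewrite !big_nil dimv0.
have [[W [WU W_inv W_neq0 W_neqU]]|U_irr] := pselect (exists W,
    [/\ (W <= U)%VS, invariant_subspace pi W, W != 0%VS & W != U]); last first.
  exists [:: U]; rewrite !big_seq1; split=> // W; rewrite inE => /eqP ->.
  split=> // V VU V_inv; have [->|V_neq0] := eqVneq V 0%VS; first by left.
  by right; apply/eqP/negPn/negP => V_neqU; apply: U_irr; exists V.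
have [C [C_inv WC capWC]] := invariant_complement U_inv W_inv WU.
have dimWC := dimv_disjoint_sum capWC; rewrite WC in dimWC.
have C_gt0 : (0 < \dim C)%N.
  rewrite lt0n dimv_eq0; apply: contraNneq W_neqU => C0.
  by rewrite -WC C0 addv0.
have W_gt0 : (0 < \dim W)%N by rewrite lt0n dimv_eq0.
have [|s [s_irr s_sum s_dim]] := IHn W _ W_inv.
  by rewrite (leq_trans _ dimU) // dimWC -addn1 leq_add2l.
have [|t [t_irr t_sum t_dim]] := IHn C _ C_inv.
  by rewrite (leq_trans _ dimU) // dimWC -add1n leq_add2r.
exists (s ++ t); rewrite !big_cat /= s_sum t_sum s_dim t_dim dimWC;
  split=> // V.
by rewrite mem_cat => /orP[/s_irr|/t_irr].
Qed.

Lemma irreducible_decomposition_exists :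
  exists (m : nat) (W : 'I_m -> {vspace 'cV[R]_N}),
    irreducible_decomposition pi W.
Proof.
have [|s [s_irr s_sum s_dim]] := @irreducible_seq fullv; first by move=> *;
  exact: memvf.
exists (size s), (fun i => nth 0%VS s i).
have sumE : (\sum_(i < size s) nth 0%VS s i)%VS = fullv.
  by rewrite -s_sum (big_nth 0%VS) big_mkord.
split=> //; first by move=> i; apply: s_irr; rewrite mem_nth.
by rewrite directvE /= sumE -s_dim (big_nth 0%VS) big_mkord.
Qed.

Lemma limg_haar_average_sub W : invariant_subspace pi W ->
  (linfun (mulmx (haar_average mu pi)) @: W <= W)%VS.
Proof.
move=> W_inv; have cpi := rep_entrywise_continuous pi_rep.
apply/subvP => _ /memv_imgP[x xW ->]; rewrite lfunE /=.
rewrite -[haar_average _ _]/(mx_integral mu pi) -(mx_integral_mulr _ G_compact)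
  //.
apply: mx_integral_mem => [|g]; last exact: W_inv.
by apply: entrywise_continuous_mul => //; exact: entrywise_continuous_cst.
Qed.

(** The image of [W] lies in [W] and is fixed pointwise, hence invariant, so it is 0 or [W]. In the
    second case [G] acts trivially on [W], and irreducibility forces dimension one. *)
Lemma dim_haar_average_irreducible W : irreducible_subrep pi W ->
  \dim (linfun (mulmx (haar_average mu pi)) @: W) =
    `[< trivial_irrep pi W >] :> nat.
Proof.
case=> W_neq0 W_inv W_min; set A := haar_average mu pi.
have imgP w : w \in (linfun (mulmx A) @: W)%VS -> (forall g, pi g *m w = w).
  by move=> /memv_imgP[x _ ->] g; rewrite lfunE /= mulmxA rep_haar_average.
have img_sub := limg_haar_average_sub W_inv.
have img_fix : (forall g w, w \in W -> pi g *m w = w) ->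
  (linfun (mulmx A) @: W)%VS = W.
  move=> W_fix; rewrite (@eq_in_limg _ _ _ _ _ \1%VF) ?lim1g // => w wW.
  by rewrite lfunE id_lfunE /= mul_haar_average // => g; exact: W_fix.
have [[dimW W_fix]|W_ntriv] := asboolP (trivial_irrep pi W);
  first by rewrite img_fix.
have [|->|imgW] := W_min _ img_sub; first by move=> g w /[dup] /imgP ->.
  by rewrite dimv0.
have W_fix g w : w \in W -> pi g *m w = w by rewrite -{1}imgW => /imgP.
case: W_ntriv; split=> //.
have v_neq0 : vpick W != 0 by rewrite vpick0.
(* Under a trivial action every line is invariant, so the line through a nonzero vector of [W] must
   be all of [W]. *)
have [|g w /vlineP[k ->]|/eqP|<-] := W_min <[vpick W]>%VS.
- by rewrite -memvE memv_pick.
- by rewrite W_fix ?memvZ ?memv_line ?memv_pick.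
- by rewrite -dimv_eq0 dim_vline v_neq0.
- by rewrite dim_vline v_neq0.
Qed.

Lemma dim_range_haar_average m (W : 'I_m -> {vspace 'cV[R]_N}) :
  irreducible_decomposition pi W ->
  \dim (mx_range (haar_average mu pi)) =
    #|[pred i | `[< trivial_irrep pi (W i) >]]|.
Proof.
case=> W_irr W_dir W_full; rewrite /mx_range -W_full limg_sum.
set f := linfun _.
have f_sub i : (f @: W i <= W i)%VS.
  by apply: limg_haar_average_sub; case: (W_irr i).
(* Each image stays inside its own summand, so the images inherit independence and their dimensions
   add up. *)
have /directvP -> /= : directv (\sum_i f @: W i)%VS.
  apply/directv_sumP => i _; apply/eqP;
    rewrite -subv0 -[X in (_ <= X)%VS](directv_sumP W_dir i) //.
  apply: capvS; first exact: f_sub.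
  by apply/subv_sumP => j ji; rewrite (sumv_sup j).
rewrite -sum1_card [RHS]big_mkcond; apply: eq_bigr => i _.
by rewrite dim_haar_average_irreducible // inE; case: asboolP.
Qed.
End Decomposition.

(** * Counting sign patterns of functionals *)

Section Cover.
Variables (R : realFieldType) (vT : vectType R).

(* General position of functionals on a subspace, formulated so that it passes
   to [U :&: lker (f i)] for the remaining functionals. *)
Definition functionals_gp n (U : {vspace vT})
    (f : 'I_n -> 'Hom(vT, R^o)) : Prop :=
  forall c : 'I_n -> R, (#|[pred i | c i != 0%R]| <= \dim U)%N ->
    (forall u, u \in U -> \sum_i c i * f i u = 0) -> forall i, c i = 0.

Definition realizes n (U : {vspace vT}) (f : 'I_n -> 'Hom(vT, R^o))
    (y : 'I_n -> bool) : Prop :=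
  exists2 u, u \in U & forall i, 0 < (-1) ^+ y i * f i u.

(** Prepends [a] at index [ord0], the index of the functional that the recursion removes. *)
Definition ord_cons (T : Type) n (a : T) (c : 'I_n -> T) (i : 'I_n.+1) : T :=
  oapp c a (unlift ord0 i).

Lemma ord_cons_0 T n (a : T) (c : 'I_n -> T) : ord_cons a c ord0 = a.
Proof. by rewrite /ord_cons unlift_none. Qed.

Lemma ord_cons_S T n (a : T)
    (c : 'I_n -> T) i : ord_cons a c (lift ord0 i) = c i.
Proof. by rewrite /ord_cons liftK. Qed.

Lemma card_supp_ord_cons n a (c : 'I_n -> R) :
  #|[pred i | ord_cons a c i != 0]| = ((a != 0%R) + #|[pred i | c i != 0%R]|)%N.
Proof.
rewrite -!sum1_card big_mkcond big_ord_recl [in RHS]big_mkcond !inE ord_cons_0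
  /=.
congr addn; apply: eq_bigr => i _.
by rewrite !inE ord_cons_S.
Qed.

(** If [f ord0] vanished on [U], the coefficients 1, 0, ..., 0 would form a forbidden relation with
    support of size one. A point where it does not vanish is then rescaled. *)
Lemma functionals_gp_neq0 n (U : {vspace vT}) (f : 'I_n.+1 -> 'Hom(vT, R^o)) :
  functionals_gp U f -> (0 < \dim U)%N -> exists2 u, u \in U & f ord0 u = 1.
Proof.
move=> gp U_gt0.
have [Uker|/subvPn[u uU]] := boolP (U <= lker (f ord0))%VS; last first.
  rewrite memv_ker => fu; exists ((f ord0 u)^-1 *: u); first by rewrite memvZ.
  by rewrite linearZ /= [LHS]mulVf.
suff: ord_cons 1 (fun _ : 'I_n => 0) ord0 = 0 :> R.
  by rewrite ord_cons_0 => /eqP; rewrite oner_eq0.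
apply: (gp (ord_cons 1 (fun=> 0))).
  by rewrite card_supp_ord_cons oner_eq0 eq_card0 // => i; rewrite !inE eqxx.
move=> u uU; rewrite big_ord_recl ord_cons_0 mul1r big1 ?addr0.
  by move: (subvP Uker u uU); rewrite memv_ker => /eqP.
by move=> i _; rewrite ord_cons_S mul0r.
Qed.

Lemma functionals_gp_lift n (U : {vspace vT}) (f : 'I_n.+1 -> 'Hom(vT, R^o)) :
  functionals_gp U f -> functionals_gp U (f \o lift ord0).
Proof.
move=> gp c c_supp c0 i; rewrite -(ord_cons_S 0 c); apply: gp.
  by rewrite card_supp_ord_cons eqxx.
move=> u uU; rewrite big_ord_recl ord_cons_0 mul0r add0r -[RHS](c0 u uU).
by apply: eq_bigr => j _; rewrite ord_cons_S.
Qed.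

Lemma dim_cap_lker (U : {vspace vT}) (f : 'Hom(vT, R^o)) u :
  u \in U -> f u = 1 -> \dim U = (\dim (U :&: lker f)).+1.
Proof.
move=> uU fu; rewrite -(limg_ker_dim f U) (_ : \dim (f @: U) = 1%N) ?addn1 //.
apply/eqP; rewrite eqn_leq; apply/andP; split.
  by rewrite (leq_trans (dimvS (subvf _))) // dimvf.
rewrite lt0n dimv_eq0; apply/eqP => fU0.
have := memv_img f uU; rewrite fU0 memv0 fu.
by rewrite oner_eq0.
Qed.

(** A relation on the kernel of [f ord0] extends to one on [U] by giving [f ord0] a suitable
    coefficient. The support grows by at most one, and the dimension bound by exactly one. *)
Lemma functionals_gp_cap_lker n (U : {vspace vT})
    (f : 'I_n.+1 -> 'Hom(vT, R^o)) :
  functionals_gp U f -> (0 < \dim U)%N ->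
  functionals_gp (U :&: lker (f ord0))%VS (f \o lift ord0).
Proof.
move=> gp /(functionals_gp_neq0 gp)[u0 u0U fu0] c c_supp c0 i.
(* This value is forced by the extended relation at [u0], where [f ord0] equals 1. *)
pose a := - \sum_i c i * f (lift ord0 i) u0.
rewrite -(ord_cons_S a c); apply: gp.
  by rewrite card_supp_ord_cons (dim_cap_lker u0U fu0) -addn1 addnC leq_add //
    leq_b1.
move=> u uU; rewrite big_ord_recl ord_cons_0.
have /c0 : u - f ord0 u *: u0 \in (U :&: lker (f ord0))%VS.
  rewrite memv_cap memvB ?memvZ //= memv_ker linearB linearZ /= fu0.
  by rewrite [_ *: _]mulr1 subrr.
move=> Hc0; rewrite -[RHS]Hc0 /a mulNr mulr_suml -sumrN -big_split /=;
  apply: eq_bigr => j _.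
rewrite ord_cons_S linearB /= [f _ (_ *: _)]linearZ /= mulrBr addrC.
by rewrite -mulrA [_ *: _]mulrC.
Qed.

Lemma pos_perturbation n (a b : 'I_n -> R) : (forall i, 0 < a i) ->
  exists2 e, 0 < e & forall i, e * `|b i| < a i.
Proof.
move=> a_gt0; elim: n a b a_gt0 => [|n IHn] a b a_gt0.
  by exists 1 => // -[].
have [e e_gt0 He] := IHn (a \o lift ord0) (b \o lift ord0) (fun i => a_gt0 _).
(* The summand 1 keeps the denominator positive when [b ord0] is 0 and makes the resulting
   inequality strict. *)
pose d := a ord0 / (1 + `|b ord0|).
have d_gt0 : 0 < d by rewrite divr_gt0 // ltr_wpDr.
exists (Num.min e d) => [|i]; first by rewrite lt_min e_gt0.
have [->|[j ->]] : i = ord0 \/ exists j, i = lift ord0 j.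
  by case: (unliftP ord0 i) => [j|] ->; [right; exists j | left].
  apply: (@le_lt_trans _ _ (d * `|b ord0|)).
    by rewrite ler_wpM2r // ge_min lexx orbT.
  by rewrite /d -mulrA gtr_pMr // mulrC ltr_pdivrMr ?mul1r ?ltrDr ?ltr_wpDr //
    ltr_pwDl.
by apply: le_lt_trans (He j); rewrite ler_wpM2r // ge_min lexx.
Qed.

(** Strict inequalities survive a small move along [v]. Only the size of [d] is prescribed, so that
    one [e] serves both directions. *)
Lemma realizes_perturbation n (U : {vspace vT})
    (f : 'I_n -> 'Hom(vT, R^o)) y u v :
  u \in U -> v \in U -> (forall i, 0 < (-1) ^+ y i * f i u) ->
  exists2 e, 0 < e & forall d, `|d| = e -> (u + d *: v \in U) /\
     (forall i, 0 < (-1) ^+ y i * f i (u + d *: v)).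
Proof.
move=> uU vU fu_gt0;
  have [e e_gt0 He] := pos_perturbation (fun i => f i v) fu_gt0.
exists e => // d dE; split=> [|i]; first by rewrite memvD ?memvZ.
rewrite linearD linearZ /= mulrDr -ltrBlDr sub0r.
apply: le_lt_trans (He i); rewrite -dE.
by rewrite (le_trans (ler_norm _)) // normrN normrM normr_sign mul1r normrM.
Qed.

Lemma realizes_ord_cons n (U : {vspace vT}) (f : 'I_n.+1 -> 'Hom(vT, R^o)) b y :
  realizes U f (ord_cons b y) <->
    exists u, [/\ u \in U, 0 < (-1) ^+ b * f ord0 u &
    forall i, 0 < (-1) ^+ y i * f (lift ord0 i) u].
Proof.
split=> [[u uU Hu]|[u [uU H0 Hu]]]; exists u => //.
  split=> // [|i]; first by have := Hu ord0; rewrite ord_cons_0.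
  by have := Hu (lift ord0 i); rewrite ord_cons_S.
by move=> i; case: (unliftP ord0 i) => [j|] ->; rewrite ?ord_cons_S ?ord_cons_0.
Qed.

(** A realizing [u] on which [f ord0] vanishes is moved slightly along [u0], which makes [f ord0]
    positive and keeps the other signs. *)
Lemma realizes_ord_cons_or n (U : {vspace vT})
    (f : 'I_n.+1 -> 'Hom(vT, R^o)) y u0 :
  u0 \in U -> f ord0 u0 = 1 ->
  realizes U f (ord_cons false y) \/ realizes U f (ord_cons true y) <->
  realizes U (f \o lift ord0) y.
Proof.
move=> u0U fu0; split=> [[] /realizes_ord_cons[u [uU _ Hu]]|[u uU Hu]];
  try by exists u.
have [fu|fu|fu] := ltgtP (f ord0 u) 0.
- by right; apply/realizes_ord_cons; exists u; split;
    rewrite // expr1 mulN1r oppr_gt0.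
- by left; apply/realizes_ord_cons; exists u; split; rewrite // expr0 mul1r.
have [e e_gt0 /(_ e)[|eU He]] := realizes_perturbation uU u0U Hu;
  first exact: gtr0_norm.
left; apply/realizes_ord_cons; exists (u + e *: u0); split => //.
by rewrite expr0 mul1r linearD linearZ /= fu fu0 add0r [_ *: _]mulr1.
Qed.

Lemma realizes_ord_cons_and n (U : {vspace vT})
    (f : 'I_n.+1 -> 'Hom(vT, R^o)) y u0 :
  u0 \in U -> f ord0 u0 = 1 ->
  realizes U f (ord_cons false y) /\ realizes U f (ord_cons true y) <->
  realizes (U :&: lker (f ord0))%VS (f \o lift ord0) y.
Proof.
move=> u0U fu0; split.
  case=> /realizes_ord_cons[u [uU]]; rewrite expr0 mul1r => fu Hu.
  move=> /realizes_ord_cons[v [vU]]; rewrite expr1 mulN1r => fv Hv.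
  (* Both weights are positive since [f ord0] is negative at [v] and positive at [u]; the segment
     from [u] to [v] crosses the kernel in this direction. *)
  exists (- f ord0 v *: u + f ord0 u *: v).
    rewrite memv_cap memvD ?memvZ //= memv_ker linearD !linearZ /=.
    by rewrite ![_ *: _]mulrC mulrN addrC mulrC subrr.
  move=> i; rewrite linearD !linearZ /= mulrDr addr_gt0 //.
    by rewrite mulrCA mulr_gt0.
  by rewrite mulrCA mulr_gt0.
move=> [u]; rewrite memv_cap memv_ker => /andP[uU /eqP fu] Hu.
have [e e_gt0 He] := realizes_perturbation uU u0U Hu; split;
  apply/realizes_ord_cons.
  have [|eU Hv] := He e; first exact: gtr0_norm.
  exists (u + e *: u0); split => //.
  by rewrite expr0 mul1r linearD linearZ /= fu fu0 add0r [_ *: _]mulr1.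
have [|eU Hv] := He (- e); first by rewrite normrN gtr0_norm.
exists (u + - e *: u0); split => //.
by rewrite expr1 linearD linearZ /= fu fu0 add0r [_ *: _]mulr1 mulN1r opprK.
Qed.

Lemma card_pred_ord_cons n (Q : pred {ffun 'I_n.+1 -> bool}) :
  #|Q| =
    (#|[pred y : {ffun 'I_n -> bool} | Q [ffun i => ord_cons false y i]]| +
     #|[pred y : {ffun 'I_n -> bool} | Q [ffun i => ord_cons true y i]]|)%N.
Proof.
pose h (p : bool * {ffun 'I_n -> bool}) : {ffun 'I_n.+1 -> bool} :=
  [ffun i => ord_cons p.1 p.2 i].
have h_bij : bijective h.
  exists (fun y : {ffun _ -> _} => (y ord0, [ffun i => y (lift ord0 i)])).
    move=> [b y]; rewrite /h !ffunE ord_cons_0 /=; congr (_, _).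
    by apply/ffunP => i; rewrite !ffunE ord_cons_S.
  move=> y; apply/ffunP => i; rewrite ffunE /=.
  by case: (unliftP ord0 i) => [j|] ->; rewrite ?ord_cons_S ?ord_cons_0 ?ffunE.
rewrite -!sum1_card big_mkcond (reindex h) /=; last exact: onW_bij.
rewrite -(pair_bigA _ (fun b y => if h (b, y) \in Q then 1%N else 0%N)) /=.
by rewrite big_bool addnC; congr (_ + _)%N; rewrite -big_mkcond.
Qed.

Definition sign_count n (U : {vspace vT}) (f : 'I_n -> 'Hom(vT, R^o)) : nat :=
  #|[pred y : {ffun 'I_n -> bool} | `[< realizes U f y >]]|.

Lemma realizes_ext n (U : {vspace vT}) (f : 'I_n -> 'Hom(vT, R^o)) y y' :
  y =1 y' -> realizes U f y <-> realizes U f y'.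
Proof. by move=> /funext ->. Qed.

(** Cover's recursion by inclusion and exclusion: the patterns extendable by [false] and those
    extendable by [true] have as union the patterns realized on [U], and as intersection those
    realized on the kernel. *)
Lemma sign_countS n (U : {vspace vT}) (f : 'I_n.+1 -> 'Hom(vT, R^o)) u0 :
  u0 \in U -> f ord0 u0 = 1 ->
  sign_count U f = (sign_count U (f \o lift ord0) +
                   sign_count (U :&: lker (f ord0)) (f \o lift ord0))%N.
Proof.
move=> u0U fu0; rewrite /sign_count card_pred_ord_cons -cardUI; congr (_ + _)%N.
  apply: eq_card => y; rewrite !inE /= -asbool_or; apply: asbool_equiv_eq.
  by rewrite !(realizes_ext _ _ (ffunE _));
    exact: (realizes_ord_cons_or _ u0U fu0).
apply: eq_card => y; rewrite !inE /= -asbool_and; apply: asbool_equiv_eq.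
by rewrite !(realizes_ext _ _ (ffunE _));
  exact: (realizes_ord_cons_and _ u0U fu0).
Qed.

Lemma sign_count_ord0 (U : {vspace vT}) (f : 'I_0 -> 'Hom(vT, R^o)) :
    sign_count U f = 1%N.
Proof.
rewrite /sign_count (eq_card (_ : _ =i predT)) => [|y].
  by rewrite card_ffun card_bool card_ord expn0.
by rewrite !inE; apply/asboolP; exists 0; [exact: mem0v | case].
Qed.

Lemma sign_count_dim0 n (U : {vspace vT}) (f : 'I_n.+1 -> 'Hom(vT, R^o)) :
  \dim U = 0%N -> sign_count U f = 0%N.
Proof.
move=> /eqP; rewrite dimv_eq0 => /eqP ->; apply: eq_card0 => y; rewrite !inE.
apply/asboolP => -[u]; rewrite memv0 => /eqP -> /(_ ord0).
by rewrite linear0 mulr0 ltxx.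
Qed.

Lemma cover_count n (U : {vspace vT}) (f : 'I_n.+1 -> 'Hom(vT, R^o)) :
  functionals_gp U f ->
    sign_count U f = (2 * \sum_(0 <= k < \dim U) 'C(n, k))%N.
Proof.
elim: n U f => [|n IHn] U f gp.
  have [/eqP U0|U_gt0] := posnP (\dim U).
    by rewrite sign_count_dim0 ?(eqP U0) // big_nil.
  have [u0 u0U fu0] := functionals_gp_neq0 gp U_gt0.
  rewrite (sign_countS u0U fu0) !sign_count_ord0 (dim_cap_lker u0U fu0).
  by rewrite big_nat_recl // bin0 big1 // => i _; rewrite bin0n.
have [/eqP U0|U_gt0] := posnP (\dim U).
  by rewrite sign_count_dim0 ?(eqP U0) // big_nil.
have [u0 u0U fu0] := functionals_gp_neq0 gp U_gt0.
rewrite (sign_countS u0U fu0) IHn; last exact: functionals_gp_lift.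
rewrite IHn; last exact: functionals_gp_cap_lker.
rewrite -mulnDr (dim_cap_lker u0U fu0); congr (_ * _)%N.
(* Splitting off the term for [k = 0] aligns the two sums, and Pascal's rule matches the remaining
   terms. *)
by rewrite !big_nat_recl // !bin0 -addnA -big_split /=; congr (_ + _)%N.
Qed.
End Cover.

(** * Separating manifolds *)

Lemma dotmx_eq0 (R : realFieldType) N (v : 'cV[R]_N) :
    (v^T *m v) 0 0 = 0 -> v = 0.
Proof.
rewrite mxE => /eqP; rewrite psumr_eq0 => [/allP v0|i _]; last first.
  by rewrite mxE -expr2 sqr_ge0.
apply/colP => i; have := v0 i (mem_index_enum i).
by rewrite !mxE -expr2 sqrf_eq0 => /eqP.
Qed.

(** [M^T] is injective on the range of [M]: if [M^T *m (M *m x)] is 0, then [M *m x] has norm 0. *)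
Lemma dim_mx_range_trmx_le (R : realType) N (M : 'M[R]_N) :
  (\dim (mx_range M) <= \dim (mx_range M^T))%N.
Proof.
rewrite -(@limg_dim_eq _ _ _ (linfun (mulmx M^T)) (mx_range M)).
  by apply: dimvS; apply: limgS; exact: subvf.
apply/eqP; rewrite -subv0; apply/subvP => y.
rewrite memv_cap memv0 memv_ker lfunE /= => /andP[/mem_mx_range[x ->] /eqP Mx0].
by apply/eqP/dotmx_eq0; rewrite trmx_mul -mulmxA Mx0 mulmx0 mxE.
Qed.

Lemma dim_mx_range_trmx (R : realType) N (M : 'M[R]_N) :
  \dim (mx_range M^T) = \dim (mx_range M).
Proof.
apply/eqP; rewrite eqn_leq dim_mx_range_trmx_le andbT.
by rewrite -{2}[M]trmxK dim_mx_range_trmx_le.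
Qed.

Definition dotmx (R : realType) N (r u : 'cV[R]_N) : R^o := (u^T *m r) 0 0.

Lemma dotmx_is_linear (R : realType) N (r : 'cV[R]_N) : linear (dotmx r).
Proof. by move=> a u v; rewrite /dotmx linearP mulmxDl -scalemxAl !mxE. Qed.

HB.instance Definition _ (R : realType) N (r : 'cV[R]_N) :=
  GRing.isLinear.Build R 'cV[R]_N R^o _ (dotmx r) (dotmx_is_linear r).

(** A relation between the functionals on the range of [A^T] is evaluated at [A^T *m z], with [z]
    the same combination of the points [A *m r i]. The result is the squared norm of [z], so the
    points satisfy the relation as well. *)
Lemma general_position_functionals (R : realType) N P (A : 'M[R]_N)
    (r : 'I_P -> 'cV[R]_N) :
  general_position (mx_range A) (fun i => A *m r i) ->
  functionals_gp (mx_range A^T) (fun i => linfun (dotmx (r i))).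
Proof.
move=> [_ gp] c c_supp c0.
pose z := \sum_i c i *: (A *m r i).
have z0 : z = 0.
  apply: dotmx_eq0.
  have /c0 <- : A^T *m z \in mx_range A^T by apply/mem_mx_range; exists z.
  rewrite {2}/z mulmx_sumr summxE; apply: eq_bigr => i _.
  by rewrite lfunE /= /dotmx trmx_mul trmxK -mulmxA -scalemxAr mxE.
(* General position gives freeness only for small subfamilies, so the relation is restricted to its
   support. *)
pose S : {set 'I_P} := [set i | c i != 0]%SET.
have S_le : (#|S| <= \dim (mx_range A))%N by rewrite cardsE -dim_mx_range_trmx.
have /freeP S_free : free [tuple of [seq A *m r i | i <- enum_tuple S]] :=
  gp _ S_le.
move=> i; have [iS|] := boolP (i \in S); last by rewrite inE negbK => /eqP.
rewrite -(enum_rankK_in iS iS).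
apply: (S_free (fun j => c (enum_val j))).
rewrite -[RHS]z0 /z (bigID (mem S)) /= [X in _ = _ + X]big1 ?addr0 => [|j];
  last first.
  by rewrite inE negbK => /eqP ->; rewrite scale0r.
rewrite [RHS]big_enum_val; apply: eq_bigr => j _.
by rewrite (nth_map i) -?cardE // -enum_val_nth.
Qed.

Lemma linearly_separable_manifold (R : realType) (G : topGroupType)
    (mu : probability (borelType G) R) N (pi : G -> 'M[R]_N) P
    (r : 'I_P -> 'cV[R]_N) (y : {ffun 'I_P -> bool}) :
  compact [set: G] -> normalized_haar mu -> continuous_representation pi ->
  linearly_separable (fun i => manifold pi (r i)) y <->
  realizes (mx_range (haar_average mu pi)^T) (fun i => linfun (dotmx (r i))) y.
Proof.
move=> G_compact mu_haar pi_rep;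
  split=> [[w w_sep]|[u /mem_mx_range[v ->] v_sep]].
  exists ((haar_average mu pi)^T *m w); first by apply/mem_mx_range; exists w.
  move=> i; rewrite lfunE /= /dotmx trmx_mul trmxK -mulmxA.
  by apply: haar_average_separable => // g; apply: w_sep; exists g.
exists ((haar_average mu pi)^T *m v) => i _ [g _ <-]; have := v_sep i.
by rewrite lfunE /= /dotmx trmx_mul trmxK !mulmxA -[v^T *m _ *m pi g]mulmxA
  haar_average_rep.
Qed.

Theorem theorem1 (R : realType) (G : topGroupType)
    (G_compact : compact [set: G])
    (mu : probability (borelType G) R) (mu_haar : normalized_haar mu)
    (N : nat) (pi : G -> 'M[R]_N) (pi_rep : continuous_representation pi)
    (P : nat) (P_gt0 : (1 <= P)%N) (r : 'I_P -> 'cV[R]_N)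
    (r_gen : general_position (mx_range (haar_average mu pi))
               (fun i => haar_average mu pi *m r i)) :
  let V0 := mx_range (haar_average mu pi) in
  let N0 := \dim V0 in
  [/\ (forall w : 'cV[R]_N, w \in V0 <-> (forall g : G, pi g *m w = w)),
      separable_fraction (fun i => manifold pi (r i)) = cover_fraction R P N0,
      (exists (m : nat) (W : 'I_m -> {vspace 'cV[R]_N}),
         irreducible_decomposition pi W) &
      (forall (m : nat) (W : 'I_m -> {vspace 'cV[R]_N}),
         irreducible_decomposition pi W ->
         N0 = #|[pred i | `[< trivial_irrep pi (W i) >]]|)].
Proof.
split.
- exact: mem_range_haar_average.
(* With [P = n.+1], the binomials ['C(P - 1, k)] become the ['C(n, k)] of the count, and the factor
   2 over [2 ^+ P] becomes [2 ^ (1 - P)]. *)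
- case: P P_gt0 r r_gen => // n _ r /general_position_functionals/cover_count.
  rewrite dim_mx_range_trmx /separable_fraction /cover_fraction => count.
  set A := haar_average mu pi in count *.
  rewrite (_ : #|_| = (2 * \sum_(0 <= k < \dim (mx_range A)) 'C(n, k))%N).
    rewrite natrM natr_sum exprS invfM mulrA [_ / 2]mulrAC.
    rewrite divff ?pnatr_eq0 // mul1r.
    rewrite mulrC subn1 -[n.+1]addn1 PoszD opprD addrCA subrr addr0.
    by rewrite exprnN addn1.
  rewrite -count; apply: eq_card => y; rewrite !inE; apply: asbool_equiv_eq.
  exact: linearly_separable_manifold.
- exact: (irreducible_decomposition_exists G_compact mu_haar pi_rep).
- by move=> m W; exact: dim_range_haar_average.
Qed.
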